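(* Let $G$ be a finite group and let $\alpha\in\operatorname{Aut}(G)$. The following statements are equivalent: (1) $\alpha$ is an inner automorphism of $G$. (2) $\alpha$ extends to every finite group containing $G$; that is, for every finite group $H$ having $G$ as a subgroup there exists $\beta\in\operatorname{Aut}(H)$ with $\beta(x)=\alpha(x)$ for all $x\in G$. (3) $\alpha$ lifts to every finite group $\hat{G}$ such that $\hat{G}/N\cong G$ for some characteristic subgroup $N\le\hat{G}$; that is, for every finite group $\hat{G}$, every characteristic subgroup $N$ of $\hat{G}$ and every isomorphism $\theta:\hat{G}/N\to G$ there exists $\beta\in\operatorname{Aut}(\hat{G})$ with $\theta(\beta(x)N)=\alpha(\theta(xN))$ for all $x\in\hat{G}$.
   Context: An automorphism $\alpha$ of a group $G$ is inner if there exists $g\in G$ such that $\alpha(x)=gxg^{-1}$ for all $x\in G$. *)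

(* Defs.v *)
From mathcomp Require Import all_boot all_fingroup.

Set Implicit Arguments.
Unset Strict Implicit.
Unset Printing Implicit Defensive.

Local Open Scope group_scope.

Definition inner_automorphism (gT : finGroupType) (G : {group gT})
    (alpha : {perm gT}) : Prop :=
  exists2 g, g \in G & forall x, x \in G -> alpha x = g * x * g^-1.

(* Overgroups of G need not live inside the ambient type gT, so "H has G as a
   subgroup" is given by an embedding iota of G into H. *)
Definition extends_to_overgroups (gT : finGroupType) (G : {group gT})
    (alpha : {perm gT}) : Prop :=
  forall (hT : finGroupType) (H : {group hT}) (iota : {morphism G >-> hT}),
    'injm iota -> iota @* G \subset H ->
  exists2 beta, beta \in Aut H &
    forall x, x \in G -> beta (iota x) = iota (alpha x).

Definition lifts_to_characteristic_extensions (gT : finGroupType)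
    (G : {group gT}) (alpha : {perm gT}) : Prop :=
  forall (hT : finGroupType) (Ghat N : {group hT})
      (theta : {morphism Ghat / N >-> gT}),
    N \char Ghat -> isom (Ghat / N) G theta ->
  exists2 beta, beta \in Aut Ghat &
    forall x, x \in Ghat ->
      theta (coset N (beta x)) = alpha (theta (coset N x)).

(* Main.v *)
Require Import Defs.
From HB Require Import structures.
From mathcomp Require Import all_boot all_fingroup.
From mathcomp Require Import ssralg finalg zmodp cyclic.

Set Implicit Arguments.
Unset Strict Implicit.
Unset Printing Implicit Defensive.

Local Open Scope group_scope.

(** An inner automorphism extends to every overgroup, as conjugation by the
image of its conjugator, and lifts to every extension, as conjugation by a
preimage of it.

Conversely, both extending and lifting force [alpha] to be inner because of a
single construction, [inner_cover]: every finite group K is the image of a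
finite group H by a split epimorphism whose kernel is preserved by all
automorphisms of H, and such that each automorphism of H induces an inner
automorphism of K.  An automorphism of H that extends [alpha] on the
complement, or that lifts [alpha] along the projection, induces [alpha] on the
quotient, so [alpha] is inner.

The cover is built in two stages.

- Rigidifying elements of prime order ([prime_order_cover]).  Given u in K with
  u ^ q = 1 for a prime q, let K act on the cosets of <[u]>, let p > #|K| be
  prime, and let H be the wreath product of F_p by K for this action.
  An automorphism of H preserves the base group M and induces some g on K, and
  it embeds the centraliser of k in M into that of g k.  The order of the
  first is p to the number of cycles of k on the cosets, and likewise for
  g k.  Since u has a fixed point it has more cycles than a fixed-point-free
  element of order q could have; so g u has a fixed point too, which says that
  g u is conjugate into <[u]>.  Iterating achieves this for any finite list of
  elements ([prime_order_cover_seq]).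

- Making the induced automorphism inner ([regular_wreath_inner]).  Apply the
  first stage to two elements of the base V of the regular wreath product of
  F_q by K, q a large prime: the point mass at 1, and a function with pairwise
  distinct values whose sum is not 0.  Let A be the induced automorphism of V
  and a the one of K, so that A (y . v) = a y . A v.  The images under A
  of the two elements are scalar multiples c and c' of translates of them.
  The first fact makes A send every point mass to c times a point mass, with a
  constant c and positions dictated by a.  Then the second fact
  says that c times the distinct-valued function, moved by a, is c' times a
  translate of it.  Comparing sums gives c = c', and comparing values shows
  that a is conjugation by the translating element. *)

(** * Automorphisms and split covers *)

(** Automorphisms as plain functions, so that they compose and restrict to
quotients without transport between permutations and morphisms. *)
Definition automorphic (gT : finGroupType) (f : gT -> gT) : Prop :=
  {morph f : x y / x * y} /\ injective f.

Lemma automorphic_Aut (gT : finGroupType) (beta : {perm gT}) :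
  beta \in Aut [set: gT] -> automorphic beta.
Proof.
move=> beta_aut; split; last exact: perm_inj.
by move=> x y; rewrite (morphicP (Aut_morphic beta_aut)) ?inE.
Qed.

(** A split epimorphism along which every automorphism [f] of the cover descends
to an automorphism of the base satisfying [P].  The existence of the induced
automorphism is what makes the kernel of [pi] characteristic. *)
Definition split_cover (hT kT : finGroupType) (pi : hT -> kT)
    (sigma : kT -> hT) (P : (kT -> kT) -> Prop) : Prop :=
  [/\ {morph pi : x y / x * y}, {morph sigma : x y / x * y},
      cancel sigma pi &
      forall f, automorphic f ->
        exists g, [/\ automorphic g, forall h, pi (f h) = g (pi h) & P g]].

Lemma morph_one (gT hT : finGroupType) (f : gT -> hT) :
  {morph f : x y / x * y} -> f 1 = 1.
Proof. by move=> fM; apply: (mulgI (f 1)); rewrite -fM !mulg1. Qed.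

Lemma morph_exp (gT hT : finGroupType) (f : gT -> hT) n :
  {morph f : x y / x * y} -> {morph f : x / x ^+ n}.
Proof.
move=> fM x; elim: n => [|n IHn]; first by rewrite !expg0 morph_one.
by rewrite !expgS fM IHn.
Qed.

Lemma morph_inv (gT hT : finGroupType) (f : gT -> hT) :
  {morph f : x y / x * y} -> {morph f : x / x^-1}.
Proof.
by move=> fM x; apply: (mulgI (f x)); rewrite -fM !mulgV morph_one.
Qed.

Lemma coprime_exp_eq1 (gT : finGroupType) (x : gT) n :
  coprime #|gT| n -> x ^+ n = 1 -> x = 1.
Proof.
move=> co xn1; apply/eqP; rewrite -order_eq1 -dvdn1 -(eqP co) dvdn_gcd.
by rewrite -cardsT order_dvdG ?inE // order_dvdn xn1 eqxx.
Qed.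

(** When the kernel has exponent dividing an [n] prime to the order of the
quotient, it consists of the elements killed by [n], whence its invariance
under automorphisms. *)
Lemma induced_automorphism (hT kT : finGroupType) (pi : hT -> kT)
    (sigma : kT -> hT) n (f : hT -> hT) :
    {morph pi : x y / x * y} -> {morph sigma : x y / x * y} ->
    cancel sigma pi -> coprime #|kT| n ->
    (forall h, pi h = 1 -> h ^+ n = 1) -> automorphic f ->
  exists2 g, automorphic g & forall h, pi (f h) = g (pi h).
Proof.
move=> piM siM siK co kern [fM f_inj].
have fker h : pi h = 1 -> pi (f h) = 1.
  move=> /kern hn1; apply: (coprime_exp_eq1 co).
  by rewrite -!morph_exp // hn1 !morph_one.
pose g k := pi (f (sigma k)).
have gE h : pi (f h) = g (pi h).
  have /fker : pi (h * (sigma (pi h))^-1) = 1.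
    by rewrite piM morph_inv // siK mulgV.
  rewrite fM piM morph_inv // morph_inv // => /(canRL (mulgK _)).
  by rewrite mul1g invgK.
exists g => //; split; first by move=> x y; rewrite /g siM fM piM.
have [f' _ f'K] := injF_bij f_inj.
apply: (can_inj (canF_sym (f := pi \o f' \o sigma) _)) => k /=.
by rewrite -gE f'K siK.
Qed.

(** * Permutational wreath products *)

Section Wreath.

Variables (A : finZmodType) (X : finType) (kT : finGroupType).
Variable to : {action kT &-> X}.

(** The argument [to] makes the type determine the group law.  As [to] is a
right action, precomposition [wact] with it is a left action on functions. *)
Definition wreath_of of {action kT &-> X} : Type := ({ffun X -> A} * kT)%type.
Local Notation wreath := (wreath_of to).

HB.instance Definition _ := Finite.on wreath.

Definition wact (k : kT) (m : {ffun X -> A}) : {ffun X -> A} :=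
  [ffun x => m (to x k)].

Lemma wact1 m : wact 1 m = m.
Proof. by apply/ffunP=> x; rewrite ffunE act1. Qed.

Lemma wactM k l m : wact (k * l) m = wact k (wact l m).
Proof. by apply/ffunP=> x; rewrite !ffunE actM. Qed.

Lemma wactD k : {morph wact k : m m' / (m + m')%R}.
Proof. by move=> m m'; apply/ffunP=> x; rewrite !ffunE. Qed.

Lemma wactN k : {morph wact k : m / (- m)%R}.
Proof. by move=> m; apply/ffunP=> x; rewrite !ffunE. Qed.

Definition wmul (u v : wreath) : wreath :=
  ((u.1 + wact u.2 v.1)%R, u.2 * v.2).
Definition wone : wreath := (0%R, 1).
Definition winv (u : wreath) : wreath := ((- wact u.2^-1 u.1)%R, u.2^-1).

Lemma wmulA : associative wmul.
Proof.
by move=> u v w; rewrite /wmul /= wactD wactM mulgA GRing.addrA.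
Qed.

Lemma wmul1 : left_id wone wmul.
Proof. by case=> m k; rewrite /wmul /= wact1 GRing.add0r mul1g. Qed.

Lemma wmulV : left_inverse wone winv wmul.
Proof. by case=> m k; rewrite /wmul /winv /= GRing.addNr mulVg. Qed.

HB.instance Definition _ := Finite_isGroup.Build wreath wmulA wmul1 wmulV.

Definition wproj (u : wreath) : kT := u.2.
Definition wlift (k : kT) : wreath := (0%R, k).
Definition wbase (m : {ffun X -> A}) : wreath := (m, 1).

Lemma wprojM : {morph wproj : u v / u * v}. Proof. by []. Qed.

Lemma wliftM : {morph wlift : k l / k * l}.
Proof.
move=> k l; congr pair; apply/ffunP=> x.
by rewrite !ffunE GRing.add0r.
Qed.

Lemma wliftK : cancel wlift wproj. Proof. by []. Qed.

Lemma wbaseM : {morph wbase : m m' / (m + m')%R >-> m * m'}.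
Proof. by move=> m m'; congr pair; rewrite /= ?wact1 ?mulg1. Qed.

Lemma wbase_exp m n : wbase m ^+ n = wbase (m *+ n)%R.
Proof.
elim: n => [|n IHn]; first by rewrite expg0 GRing.mulr0n.
by rewrite expgS IHn GRing.mulrS wbaseM.
Qed.

Lemma wproj_eq1 u : wproj u = 1 -> u = wbase u.1.
Proof. by case: u => m k /= ->. Qed.

Lemma wbase_conj m u : u * wbase m * u^-1 = wbase (wact u.2 m).
Proof.
congr pair; rewrite /= ?mulg1 ?mulgV //.
rewrite -wactN -wactM mulgV wact1.
by rewrite GRing.addrC GRing.addrA GRing.addNr GRing.add0r.
Qed.

Variables (p : nat) (Ap : forall a : A, (a *+ p = 0)%R).
Hypothesis co_p : coprime #|kT| p.

Lemma wreath_induced (f : wreath -> wreath) : automorphic f ->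
  exists2 g, automorphic g & forall h, wproj (f h) = g (wproj h).
Proof.
apply: (induced_automorphism wprojM wliftM wliftK co_p) => h /wproj_eq1->.
rewrite wbase_exp; congr wbase; apply/ffunP=> x.
by rewrite ffunMnE Ap ffunE.
Qed.

(** ** Counting fixed functions by cycles *)

Definition cycle_orbits (k : kT) : {set {set X}} :=
  [set orbit to <[k]> x | x in [set: X]].

Definition wfixed (k : kT) : {set {ffun X -> A}} := [set m | wact k m == m].

Lemma wfixed_orbit k m x y :
  m \in wfixed k -> y \in orbit to <[k]> x -> m y = m x.
Proof.
rewrite inE => /eqP mk /orbitP[_ /cycleP[n ->] <-].
rewrite -[in RHS](_ : wact (k ^+ n) m = m) ?ffunE //.
elim: n => [|n IHn]; first by rewrite expg0 wact1.
by rewrite expgS wactM IHn mk.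
Qed.

(** A function fixed by [k] is a free choice of one value per cycle of [k]. *)
Lemma card_wfixed k : #|wfixed k| = (#|A| ^ #|cycle_orbits k|)%N.
Proof.
(* Functions on cycles are coded as functions on all sets that vanish off the
   cycles. *)
pose D : pred {set X} := fun B => B \in cycle_orbits k.
pose F (h : {ffun {set X} -> A}) : {ffun X -> A} :=
  [ffun x => h (orbit to <[k]> x)].
rewrite -[#|cycle_orbits k|]/#|D| -(card_pffun_on 0%R D predT).
have D_orbit x : D (orbit to <[k]> x) by apply: imset_f.
rewrite -(card_in_imset (f := F) (D := pffun_on 0%R D predT)).
  apply: eq_card => m; apply/idP/imsetP => [mk | [h _ ->]]; last first.
    rewrite inE; apply/eqP/ffunP=> x; rewrite !ffunE; congr (h _).
    by apply/orbit_eqP/mem_orbit/cycle_id.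
  pose h : {ffun {set X} -> A} :=
    [ffun B => if D B then if [pick x in B] is Some x then m x else 0%R
               else 0%R].
  exists h.
    apply/pffun_onP; split=> //; apply/subsetP=> B.
    by rewrite inE ffunE; case: ifP => //; rewrite eqxx.
  apply/ffunP=> x; rewrite !ffunE D_orbit; case: pickP => [y | /(_ x)].
    by move/(wfixed_orbit mk).
  by rewrite orbit_refl.
move=> h h' /pffun_onP[hD _] /pffun_onP[h'D _] /ffunP eqF.
have off (h0 : {ffun {set X} -> A}) B :
    {subset 0%R.-support h0 <= D} -> ~~ D B -> h0 B = 0%R.
  by move=> sub /negP DB; apply/eqP/negPn/negP => /sub /DB.
apply/ffunP=> B; have [/imsetP[x _ ->] | DB] := boolP (D B).
  by have := eqF x; rewrite !ffunE.
by rewrite !off //; apply/subsetP.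
Qed.

Lemma sum_card_cycle_orbits k : (\sum_(B in cycle_orbits k) #|B|)%N = #|X|.
Proof.
by rewrite acts_sum_card_orbit ?cardsT //; apply/actsP=> a _ x; rewrite !inE.
Qed.

Lemma card_cycle_orbit q k x : k ^+ q = 1 -> #|orbit to <[k]> x| %| q.
Proof.
move=> kq1; apply: dvdn_trans (dvdn_orbit _ _ _) _.
by rewrite -orderE order_dvdn kq1.
Qed.

(** The cycle lengths divide [q], so none exceeds [q], and [x] has a cycle of
length 1 < [q]. *)
Lemma cycle_orbits_fixed_point q k x : prime q -> k ^+ q = 1 -> to x k = x ->
  #|X| < q * #|cycle_orbits k|.
Proof.
move=> q_pr kq1 xk; rewrite -(sum_card_cycle_orbits k) mulnC -sum_nat_const.
have Ox : orbit to <[k]> x \in cycle_orbits k by apply: imset_f.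
rewrite (bigD1 _ Ox) [ltnRHS](bigD1 _ Ox) /= -addSn leq_add //.
  rewrite (leq_trans _ (prime_gt1 q_pr)) // ltnS.
  rewrite (_ : orbit _ _ _ = [set x]) ?cards1 //.
  apply/setP=> y; rewrite inE; apply/orbitP/eqP => [[_ /cycleP[n ->] <-]|->].
    elim: n => [|n IHn]; first by rewrite expg0 act1.
    by rewrite expgS actM xk.
  by exists 1; rewrite ?act1 ?group1.
apply: leq_sum => _ /andP[/imsetP[y _ ->] _].
by apply: dvdn_leq (prime_gt0 q_pr) (card_cycle_orbit _ kq1).
Qed.

(** The cycle lengths divide the prime [q] and differ from 1. *)
Lemma cycle_orbits_free q k : prime q -> k ^+ q = 1 ->
  (forall x, to x k <> x) -> #|X| = (q * #|cycle_orbits k|)%N.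
Proof.
move=> q_pr kq1 free.
rewrite -(sum_card_cycle_orbits k) mulnC -sum_nat_const.
apply: eq_bigr => _ /imsetP[x _ ->].
have [_ q_dv] := primeP q_pr.
have /q_dv/orP[/eqP/card_orbit1 Ox | /eqP//] := card_cycle_orbit x kq1.
have /free[] : to x k = x.
by apply/set1P; rewrite -Ox mem_orbit ?cycle_id.
Qed.

(** The functions fixed by [k] form its centraliser in the base group, which [f]
maps into the centraliser of [g k]. *)
Lemma wreath_induced_wfixed (f : wreath -> wreath) g k : automorphic f ->
    (forall h, wproj (f h) = g (wproj h)) ->
  #|wfixed k| <= #|wfixed (g k)|.
Proof.
move=> [fM f_inj] fg.
pose f' m := (f (wbase m)).1.
have f'E m : f (wbase m) = wbase (f' m).
  by apply: wproj_eq1; rewrite fg -(fg 1) morph_one.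
have f'_inj : injective f'.
  move=> m m' eq_m.
  by have /f_inj[] : f (wbase m) = f (wbase m') by rewrite !f'E eq_m.
rewrite -(card_imset _ f'_inj); apply: subset_leq_card.
apply/subsetP=> _ /imsetP[m + ->]; rewrite !inE => /eqP mk.
have := wbase_conj m (wlift k); rewrite [wact _ _]mk => /(congr1 f).
rewrite !fM morph_inv // f'E wbase_conj => [[]].
by rewrite -[(f _).2]/(wproj _) fg => ->.
Qed.

(** Otherwise [g k] would have #|X| / q cycles, and [k] strictly more, against
the comparison of their centralisers in the base group. *)
Lemma wreath_induced_fixed_point (f : wreath -> wreath) g q k x :
    automorphic f -> (forall h, wproj (f h) = g (wproj h)) ->
    (1 < #|A|) -> prime q -> k ^+ q = 1 -> (g k) ^+ q = 1 -> to x k = x ->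
  exists y, to y (g k) = y.
Proof.
move=> f_aut fg A_gt1 q_pr kq1 gkq1 xk.
have [/existsP[y /eqP] | /existsPn free] := boolP [exists y, to y (g k) == y].
  by exists y.
have := wreath_induced_wfixed k f_aut fg; rewrite !card_wfixed leq_exp2l //.
rewrite leqNgt -(ltn_pmul2l (prime_gt0 q_pr)) -(cycle_orbits_free q_pr gkq1).
  by rewrite (cycle_orbits_fixed_point q_pr kq1 xk).
by move=> y; apply/eqP/free.
Qed.

End Wreath.

(** * The action on right cosets *)

Section CosetAction.

Variables (gT : finGroupType) (L : {group gT}).

Definition coset_space := {B : {set gT} | B \in rcosets L [set: gT]}.

Lemma coset_space_proof (B : coset_space) x :
  val B :* x \in rcosets L [set: gT].
Proof.
have /rcosetsP[y _ ->] := valP B.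
by rewrite -rcosetM; apply/rcosetsP; exists (y * x); rewrite ?inE.
Qed.

Definition coset_act (B : coset_space) x : coset_space :=
  exist (fun C => C \in rcosets L [set: gT]) _ (coset_space_proof B x).

Lemma coset_act1 : coset_act^~ 1 =1 id.
Proof. by move=> B; apply: val_inj; rewrite /= mulg1. Qed.

Lemma coset_actM B : act_morph coset_act B.
Proof. by move=> x y; apply: val_inj; rewrite /= rcosetM. Qed.

Definition coset_action := TotalAction coset_act1 coset_actM.

Lemma coset_action_fixed x :
  (exists B, coset_action B x = B) <-> exists y, x ^ y \in L.
Proof.
split=> [[B /(congr1 val) /= Bx] | [y Lxy]].
  have /rcosetsP[y _ By] : sval B \in rcosets L [set: gT] := valP B.
  exists y^-1.
  have : y * x \in L :* y by rewrite -By -Bx By -rcosetM rcoset_refl.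
  by rewrite mem_rcoset conjgE invgK mulgA.
have Py : L :* y^-1 \in rcosets L [set: gT].
  by apply/rcosetsP; exists y^-1; rewrite ?inE.
exists (exist (fun C => C \in rcosets L [set: gT]) _ Py).
apply: val_inj; rewrite /= -rcosetM.
by apply/rcoset_eqP; rewrite mem_rcoset invgK -mulgA -conjgE.
Qed.

End CosetAction.

(** * Covers that rigidify elements of prime order *)

(** The cover is the wreath product for the action of [kT] on the cosets of
<[u]>: there [u] fixes a point, so its image by an induced automorphism does,
that is, has a conjugate in <[u]>. *)
Lemma prime_order_cover (kT : finGroupType) q (u : kT) :
    prime q -> u ^+ q = 1 ->
  exists (hT : finGroupType) (pi : hT -> kT) (sigma : kT -> hT),
    split_cover pi sigma (fun g => exists n x, g u = (u ^+ n) ^ x).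
Proof.
move=> q_pr uq1; have [p p_gt p_pr] := prime_above #|kT|.
pose to := coset_action <[u]>.
exists (wreath_of 'F_p to), (@wproj _ _ _ to), (@wlift _ _ _ to).
split; [by [] | exact: wliftM | by [] | move=> f f_aut].
have co_p : coprime #|kT| p.
  by rewrite coprime_sym prime_coprime // gtnNdvd // -cardsT cardG_gt0.
have [|g [gM g_inj] fg] := wreath_induced _ co_p f_aut.
  exact/GRing.mulrn_pchar/pchar_Fp.
exists g; split=> //.
have [|B uB] := (coset_action_fixed <[u]> u).2.
  by exists 1; rewrite conjg1 cycle_id.
have [||B' guB'] := wreath_induced_fixed_point f_aut fg _ q_pr uq1 _ uB.
- by rewrite card_Fp // prime_gt1.
- by rewrite -morph_exp // uq1 morph_one.
have [|y /cycleP[n gu]] := (coset_action_fixed <[u]> (g u)).1.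
  by exists B'.
by exists n, y^-1; rewrite -gu conjgK.
Qed.

(** The elements are treated one after the other: the next one is moved by the
section into the cover built so far, and that cover is covered again. *)
Lemma prime_order_cover_seq (kT : finGroupType) q (s : seq kT) : prime q ->
  exists (hT : finGroupType) (pi : hT -> kT) (sigma : kT -> hT),
    split_cover pi sigma
      (fun g => {in s, forall u, u ^+ q = 1 -> exists n x, g u = (u ^+ n) ^ x}).
Proof.
move=> q_pr; elim: s => [|u s [hT [pi [sigma [piM siM siK ext]]]]].
  by exists kT, id, id; split=> // f f_aut; exists f.
have [uq1 | uq1] := eqVneq (u ^+ q) 1; last first.
  exists hT, pi, sigma; split=> // f /ext[g [g_aut fg gP]].
  exists g; split=> //.
  by move=> v /predU1P[-> /eqP | /gP//]; rewrite (negPf uq1).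
have [|h2T [pi2 [sigma2 [pi2M si2M si2K ext2]]]] :=
    prime_order_cover (u := sigma u) q_pr.
  by rewrite -morph_exp // uq1 morph_one.
exists h2T, (pi \o pi2), (sigma2 \o sigma); split.
- by move=> x y; rewrite /= pi2M piM.
- by move=> x y; rewrite /= siM si2M.
- by move=> x; rewrite /= si2K siK.
move=> f /ext2[f1 [/ext[g [g_aut f1g gP]] ff1 [n [x f1u]]]].
exists g; split=> // [h | v]; first by rewrite /= ff1 f1g.
case/predU1P=> [-> _ | /gP//]; exists n, (pi x).
rewrite -[in LHS](siK u) -f1g f1u conjgE !piM morph_inv // morph_exp //.
by rewrite siK -conjgE.
Qed.

(** * Detecting inner automorphisms in the regular wreath product *)

Section RegularWreath.

Variables (kT : finGroupType) (q : nat).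

(** Positive, pairwise distinct values; positivity keeps their sum nonzero when
the group is trivial. *)
Definition ramp_weight (y : kT) : nat := (enum_rank y).+1.

Lemma ramp_weight_inj : injective ramp_weight.
Proof. by move=> x y [] /val_inj/enum_rank_inj. Qed.

Local Notation reg := (mulgr_action kT).
Local Notation W := (wreath_of 'F_q reg).

Definition point_mass : {ffun kT -> 'F_q} := [ffun x : kT => (x == 1%g)%:R%R].
Definition ramp : {ffun kT -> 'F_q} := [ffun x : kT => (ramp_weight x)%:R%R].

Hypothesis q_pr : prime q.
Hypothesis q_gt : \sum_y ramp_weight y < q.

Let ramp_sum_neq0 : ((\sum_y ramp_weight y)%:R != 0 :> 'F_q)%R.
Proof.
by rewrite -(GRing.dvdn_pcharf (pchar_Fp q_pr)) gtnNdvd // (bigD1 1).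
Qed.

Let natr_ramp_inj (x y : kT) :
  ((ramp_weight x)%:R = (ramp_weight y)%:R :> 'F_q)%R -> x = y.
Proof.
have lt z : ramp_weight z < q.
  by apply: leq_ltn_trans q_gt; rewrite (bigD1 z) //= leq_addr.
move/(congr1 val); rewrite /= !val_Fp_nat // !modn_small //.
exact: ramp_weight_inj.
Qed.

(** The action on the base is (y . m) x = m (x * y).  So the translate by [h0]
of the point mass at 1 is the point mass at h0^-1, and the hypothesis on
[point_mass] gives A (y^-1 . point_mass) = c times the point mass at
h0^-1 * a y.  Since [ramp] is the combination of the y^-1 . point_mass with
coefficients [ramp_weight y], evaluating A ramp at h0^-1 * a y yields
c * ramp_weight y = c' * ramp_weight (h0^-1 * a y * h).  Summing over y gives
c = c', hence y = h0^-1 * a y * h, and y = 1 shows that h = h0. *)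
Lemma regular_wreath_inner (g : W -> W) (a : kT -> kT) :
    automorphic g -> automorphic a -> (forall w, wproj (g w) = a (wproj w)) ->
    (forall m : {ffun kT -> 'F_q}, m \in [:: point_mass; ramp] ->
       exists n x, g (wbase _ m) = (wbase _ m ^+ n) ^ x) ->
  exists h, forall y, a y = h * y * h^-1.
Proof.
move=> [gM g_inj] [aM a_inj] ga conj.
pose A m := (g (wbase _ m)).1.
have AE m : g (wbase _ m) = wbase _ (A m).
  by apply: wproj_eq1; rewrite ga -(ga 1) morph_one.
have AD : {morph A : m m' / (m + m')%R}.
  move=> m m'; rewrite {1}/A wbaseM gM !AE.
  by rewrite -wbaseM.
have A0 : A 0%R = 0%R by rewrite /A (_ : wbase _ _ = 1) // morph_one.
have AMn m n : A (m *+ n)%R = (A m *+ n)%R.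
  by elim: n => // n IHn; rewrite !GRing.mulrS AD IHn.
have Aact y m : A (wact reg y m) = wact reg (a y) (A m).
  have := wbase_conj m (wlift 'F_q reg y) => /(congr1 g).
  rewrite !gM morph_inv // !AE wbase_conj => [[]].
  by rewrite -[(g _).2]/(wproj _) ga => ->.
have conjA m : m \in [:: point_mass; ramp] ->
    exists n h, forall x, (A m x = m (x * h)%g *+ n)%R.
  move=> /conj[n [u gm]]; exists n, (u^-1).2 => x.
  move: gm; rewrite AE conjgE mulgA wbase_exp -{2}[u]invgK.
  by rewrite wbase_conj => [[->]]; rewrite ffunE ffunMnE.
have [|c [h0 Apoint]] := conjA point_mass; first by rewrite inE eqxx.
have [|c' [h Aramp]] := conjA ramp; first by rewrite !inE eqxx orbT.
pose t y := h0^-1 * a y * h.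
have rampE : ramp = (\sum_y wact reg y^-1 point_mass *+ ramp_weight y)%R.
  apply/ffunP=> x; rewrite sum_ffunE (bigD1 x) //= big1 => [|y y'x].
    by rewrite ffunMnE !ffunE /= mulgV eqxx GRing.addr0.
  rewrite ffunMnE !ffunE /= -eq_mulgV1 eq_sym (negPf y'x).
  by rewrite GRing.mul0rn.
have key y :
    ((ramp_weight y)%:R * c%:R = (ramp_weight (t y))%:R * c'%:R :> 'F_q)%R.
  have := Aramp (h0^-1 * a y); rewrite [X in _ = (X *+ _)%R]ffunE -/(t y).
  rewrite rampE (big_morph A AD A0) sum_ffunE (bigD1 y) //= big1 => [|z z'y].
    rewrite AMn Aact ffunMnE ffunE Apoint ffunE /= morph_inv // mulgK mulVg.
    by rewrite eqxx GRing.addr0 GRing.mulrnAC !GRing.mulr_natr.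
  rewrite AMn Aact ffunMnE ffunE Apoint ffunE /= morph_inv //.
  rewrite -!mulgA -eq_invg_mul invgK mulgA -{1}[h0]mul1g (inj_eq (mulIg _)).
  rewrite eq_sym -eq_mulgV1 (inj_eq a_inj) eq_sym (negPf z'y).
  by rewrite !GRing.mul0rn.
have t_inj : injective t by move=> x y /mulIg/mulgI/a_inj.
(* Sum the relations over y, reindexing the right-hand side along t. *)
have eq_c : (c%:R = c'%:R :> 'F_q)%R.
  apply: (GRing.mulfI ramp_sum_neq0).
  rewrite {2}(reindex_inj t_inj) !GRing.natr_sum !GRing.mulr_suml.
  exact: eq_bigr.
(* If c vanished in 'F_q, then A would kill the point mass. *)
have c_neq0 : (c%:R != 0 :> 'F_q)%R.
  apply/eqP=> c0.
  have /g_inj[] : g (wbase reg point_mass) = g (wbase reg 0%R).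
    rewrite !AE A0; congr wbase; apply/ffunP=> x.
    by rewrite Apoint -GRing.mulr_natr c0 GRing.mulr0 ffunE.
  by move/ffunP/(_ 1)/eqP; rewrite !ffunE eqxx GRing.oner_eq0.
have tK y : t y = y.
  by apply/natr_ramp_inj/(GRing.mulIf c_neq0); rewrite [RHS]key eq_c.
have def_h : h = h0.
  by apply: (mulgI h0^-1); rewrite mulVg -(tK 1) /t morph_one ?mulg1.
by exists h0 => y; rewrite -{2}(tK y) /t def_h mulgA mulgK mulgA mulgV mul1g.
Qed.

End RegularWreath.

(** The cover of the regular wreath product that rigidifies the point mass and
the ramp. *)
Lemma inner_cover (kT : finGroupType) :
  exists (hT : finGroupType) (pi : hT -> kT) (sigma : kT -> hT),
    split_cover pi sigma (fun a => exists h, forall y, a y = h * y * h^-1).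
Proof.
have [q q_gt q_pr] := prime_above (\sum_(y : kT) ramp_weight y).
have Fq0 (x : 'F_q) : (x *+ q = 0)%R by apply/GRing.mulrn_pchar/pchar_Fp.
have co_q : coprime #|kT| q.
  rewrite coprime_sym prime_coprime // gtnNdvd //; first by rewrite -cardsT.
  by apply: leq_ltn_trans q_gt; rewrite -sum1_card leq_sum.
pose reg := mulgr_action kT; pose W := wreath_of 'F_q reg.
pose s : seq W := map (wbase reg) [:: point_mass kT q; ramp kT q].
have [hT [pi [sigma [piM siM siK ext]]]] := prime_order_cover_seq s q_pr.
exists hT, (@wproj _ _ _ reg \o pi), (sigma \o @wlift _ _ _ reg); split.
- by move=> x y /=; rewrite piM.
- by move=> x y /=; rewrite wliftM siM.
- by move=> x /=; rewrite siK.
move=> f /ext[g [g_aut fg gP]].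
have [a a_aut ga] := wreath_induced Fq0 co_q g_aut.
exists a; split=> // [h | ]; first by rewrite /= fg ga.
apply: (regular_wreath_inner q_pr q_gt g_aut a_aut ga) => m m_s.
apply: gP; first exact: map_f.
rewrite wbase_exp (_ : m *+ q = 0)%R //.
by apply/ffunP=> x; rewrite ffunMnE Fq0 ffunE.
Qed.

(** * Inner automorphisms extend and lift *)

Lemma inner_extends (gT : finGroupType) (G : {group gT}) (alpha : {perm gT}) :
  inner_automorphism G alpha -> extends_to_overgroups G alpha.
Proof.
move=> [g Gg alphaE] hT H iota _ sGH.
have Hiota x : x \in G -> iota x \in H.
  by move=> Gx; rewrite (subsetP sGH) // mem_morphim.
exists (conj_aut H (iota g)^-1).
  apply: (subsetP (Aut_conj_aut H H)).
  by rewrite mem_morphim ?(subsetP (normG H)) ?groupV ?Hiota.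
move=> x Gx; rewrite conj_autE ?groupV ?Hiota // alphaE // conjgE invgK.
by rewrite !morphM ?groupM ?groupV // morphV // mulgA.
Qed.

Lemma inner_lifts (gT : finGroupType) (G : {group gT}) (alpha : {perm gT}) :
  inner_automorphism G alpha -> lifts_to_characteristic_extensions G alpha.
Proof.
move=> [g Gg alphaE] hT Ghat N theta chN /isomP[_ theta_im].
have nNG : Ghat \subset 'N(N) by apply: char_norm.
have [h Gh def_g] : exists2 h, h \in Ghat & theta (coset N h) = g.
  move: Gg; rewrite -theta_im => /morphimP[_ _ /morphimP[h _ Gh ->] ->].
  by exists h.
have thetaG x : x \in Ghat -> theta (coset N x) \in G.
  by move=> Gx; rewrite -theta_im mem_morphim ?mem_quotient.
exists (conj_aut Ghat h^-1).
  apply: (subsetP (Aut_conj_aut Ghat Ghat)).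
  by rewrite mem_morphim ?(subsetP (normG Ghat)) ?groupV.
move=> x Gx; rewrite conj_autE ?groupV // alphaE ?thetaG // conjgE invgK mulgA.
have nN := subsetP nNG; rewrite -def_g.
rewrite !(morphM (coset_morphism N)) ?morphV ?groupM ?groupV ?nN //.
by rewrite !morphM ?morphV ?groupM ?groupV ?mem_quotient.
Qed.

(** * Extendable or liftable automorphisms are inner *)

(** [G] sits in the cover as the image of the section; reading the extension
modulo the kernel gives back [alpha]. *)
Lemma extends_inner (gT : finGroupType) (G : {group gT}) (alpha : {perm gT}) :
  alpha \in Aut G ->
  extends_to_overgroups G alpha -> inner_automorphism G alpha.
Proof.
move=> alphaG ext.
have [hT [pi [sigma [piM siM siK cover]]]] := inner_cover (subg_of G).
pose iota x := sigma (subg G x).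
have iotaM : {in G &, {morph iota : x y / x * y}}.
  by move=> x y Gx Gy; rewrite /iota (morphM (subg_morphism G)) ?siM.
have iota_inj : 'injm (Morphism iotaM).
  apply/injmP=> x y Gx Gy /(can_inj siK)/(congr1 val).
  by rewrite /= !subgK.
have [beta /automorphic_Aut/cover[a [_ betaE [h aE]]] beta_iota] :=
  ext hT [set: hT]%G (Morphism iotaM) iota_inj (subsetT _).
exists (val h) => [|x Gx]; first exact: valP.
have := congr1 pi (beta_iota x Gx); rewrite betaE /= /iota !siK aE.
move/(congr1 val); rewrite subgK ?(Aut_closed alphaG) // => <-.
by rewrite -[in RHS](@subgK _ G x Gx).
Qed.

(** The first isomorphism theorem for the projection of the cover provides the
extension to which [alpha] is lifted. *)
Lemma lifts_inner (gT : finGroupType) (G : {group gT}) (alpha : {perm gT}) :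
  alpha \in Aut G ->
  lifts_to_characteristic_extensions G alpha -> inner_automorphism G alpha.
Proof.
move=> alphaG lift.
have [hT [pi [sigma [piM siM siK cover]]]] := inner_cover (subg_of G).
pose p x : gT := val (pi x).
have pM : {in [set: hT] &, {morph p : x y / x * y}}.
  by move=> x y _ _; rewrite /p piM.
pose pm := Morphism pM.
have [theta theta_inj theta_im] := first_isom pm.
have thetaE x : theta (coset ('ker pm) x) = p x.
  have nK : x \in 'N('ker pm).
    by rewrite (subsetP (normal_norm (ker_normal _))) ?inE.
  apply/set1P; rewrite -(morphim_set1 pm) ?inE // -theta_im.
  by rewrite !mem_morphim ?mem_quotient ?in_setT ?set11 //.
have p_im : pm @* [set: hT] = G.
  apply/setP=> x; apply/morphimP/idP=> [[y _ _ ->] | Gx]; first exact: valP.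
  by exists (sigma (subg G x)); rewrite ?inE //= /p siK subgK.
have kerE x : (x \in 'ker pm) = (pi x == 1).
  by rewrite !inE /= /p -val_eqE.
have char_ker : 'ker pm \char [set: hT].
  apply/charP; split=> [|f f_inj f_im]; first exact: subsetT.
  have f_aut : automorphic f.
    split=> x y; first by rewrite morphM ?inE.
    by apply: (injmP f_inj); rewrite inE.
  have [a [[aM _] fa _]] := cover f f_aut.
  apply/eqP; rewrite eqEcard card_injm ?subsetT // leqnn andbT.
  apply/subsetP=> _ /morphimP[x _ + ->]; rewrite !kerE => /eqP pix.
  by rewrite fa pix morph_one.
have isoG : isom ([set: hT] / 'ker pm) G theta.
  by apply/isomP; split=> //; rewrite theta_im.
have [beta /automorphic_Aut/cover[a [_ betaE [h aE]]] beta_p] :=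
  lift hT [set: hT]%G ('ker pm)%G theta char_ker isoG.
exists (val h) => [|x Gx]; first exact: valP.
have := beta_p (sigma (subg G x)).
rewrite inE !thetaE /p betaE siK aE => /(_ isT).
by rewrite subgK // => <-; rewrite -[in RHS](@subgK _ G x Gx).
Qed.

Theorem mainTheorem1 (gT : finGroupType) (G : {group gT}) (alpha : {perm gT})
    (alphaG : alpha \in Aut G) :
  (inner_automorphism G alpha <-> extends_to_overgroups G alpha) /\
  (inner_automorphism G alpha <-> lifts_to_characteristic_extensions G alpha).
Proof.
split; split.
- exact: inner_extends.
- exact: extends_inner.
- exact: inner_lifts.
- exact: lifts_inner.
Qed.
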